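(* For every poset $P$, $\operatorname{iir}(P)\leq|P|$.
   Context: All posets are finite with non-empty ground sets. Given a poset $P$, a family $\mathcal{S}=\{S_x:x\in P\}$ of sets is an inclusion representation of $P$ if for all $x,y\in P$, $x\le y$ in $P$ if and only if $S_x\subseteq S_y$; $\bigcup\mathcal{S}$ is its ground set. For inclusion representations $\mathcal{S}=\{S_x\}$ and $\mathcal{S}'=\{S'_x\}$ of $P$, $\mathcal{S}$ is a reduction of $\mathcal{S}'$ if $|\bigcup\mathcal{S}|\le|\bigcup\mathcal{S}'|$ and $|S_x|\le|S'_x|$ for every $x\in P$; they are equivalent if each is a reduction of the other; $\mathcal{S}$ is a strict reduction of $\mathcal{S}'$ if it is a reduction but they are not equivalent. An inclusion representation with no strict reduction is irreducible. $\operatorname{iir}(P)$ denotes the maximum non-negative integer $w$ such that $P$ has an irreducible inclusion representation whose ground set has size $w$. *)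

(* Defs.v *)
From mathcomp Require Import all_boot all_order.

Set Implicit Arguments.
Unset Strict Implicit.
Unset Printing Implicit Defensive.

Section InclusionRepresentations.

Variables (d : Order.disp_t) (P : finPOrderType d).

Definition inclusion_rep (T : finType) (S : P -> {set T}) : Prop :=
  forall x y : P, (x <= y)%O <-> S x \subset S y.

(* The ambient type T need not be exhausted by the family, so the ground set
   is this union and not [set: T]. *)
Definition ground (T : finType) (S : P -> {set T}) : {set T} :=
  \bigcup_(x : P) S x.

(* Two representations are compared through cardinalities only, so they may
   live in different ambient types. *)
Definition reduction (T T' : finType) (S : P -> {set T}) (S' : P -> {set T'})
    : Prop :=
  #|ground S| <= #|ground S'| /\ forall x : P, #|S x| <= #|S' x|.

Definition rep_equiv (T T' : finType) (S : P -> {set T}) (S' : P -> {set T'})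
    : Prop :=
  reduction S S' /\ reduction S' S.

Definition strict_reduction (T T' : finType)
    (S : P -> {set T}) (S' : P -> {set T'}) : Prop :=
  reduction S S' /\ ~ rep_equiv S S'.

Definition irreducible_rep (T : finType) (S : P -> {set T}) : Prop :=
  inclusion_rep S /\
  ~ exists (T' : finType) (S' : P -> {set T'}),
      inclusion_rep S' /\ strict_reduction S' S.

Definition irreducible_size (w : nat) : Prop :=
  exists (T : finType) (S : P -> {set T}),
    irreducible_rep S /\ #|ground S| = w.

(* "w = iir(P)", kept relational so that the existence of the maximum is not
   hidden behind a default value. *)
Definition is_iir (w : nat) : Prop :=
  irreducible_size w /\ forall v : nat, irreducible_size v -> v <= w.

Lemma is_iir_uniq (v w : nat) : is_iir v -> is_iir w -> v = w.
Proof.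
by move=> [iv mv] [iw mw]; apply/eqP; rewrite eqn_leq mw // mv.
Qed.

End InclusionRepresentations.

(* Main.v *)
Require Import Defs.
From mathcomp Require Import all_boot all_order.
From mathcomp Require Import boolp.

(** Let S be a representation with more than |P| points, and for D ⊆ P write
    G(D) for the union of the S_x, x ∈ D.  Choose D minimizing |G(D)| - |D|.
    Comparing D with D ∪ ↓x gives |↓x \ D| <= |S_x \ G(D)| for every x, and
    comparing D with the empty set gives |G(D)| <= |D|.  Hence keeping the
    points of G(D) and replacing all the others by the principal up-sets of
    the elements outside D yields a representation that is nowhere larger and
    whose ground set is strictly smaller, so S is not irreducible. *)

Import Order.TTheory.

Set Implicit Arguments.
Unset Strict Implicit.
Unset Printing Implicit Defensive.

Section IrreducibleRepresentations.

Variables (d : Order.disp_t) (P : finPOrderType d).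

Definition down (x : P) : {set P} := [set z | (z <= x)%O].

(** A natural-number measure that makes strict reduction well-founded. *)
Definition rep_weight (T : finType) (S : P -> {set T}) : nat :=
  #|ground S| + \sum_(x : P) #|S x|.

Lemma inclusion_rep_down : inclusion_rep down.
Proof.
move=> x y; split=> [xy | /subsetP /(_ x)]; last by rewrite !inE; apply.
by apply/subsetP=> z; rewrite !inE => /le_trans; apply.
Qed.

(** If the weight did not drop, the termwise inequalities would all be equalities, making [S] and
    [S'] equivalent. *)
Lemma strict_reduction_weight (T T' : finType)
    (S : P -> {set T}) (S' : P -> {set T'}) :
  strict_reduction S S' -> rep_weight S < rep_weight S'.
Proof.
move=> [[gSS' sSS'] neq]; rewrite ltnNge; apply/negP=> wle.
have sum_le : \sum_(x : P) #|S x| <= \sum_(x : P) #|S' x| by apply: leq_sum.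
have gS'S : #|ground S'| <= #|ground S|.
  rewrite -(leq_add2r (\sum_(x : P) #|S' x|)); apply: leq_trans wle _.
  by rewrite leq_add2l.
apply: neq; split=> //; split=> // x.
have : \sum_(x : P) #|S' x| <= \sum_(x : P) #|S x|.
  rewrite -(leq_add2l #|ground S'|); apply: leq_trans wle _.
  by rewrite leq_add2r.
rewrite (bigD1 x) //= [X in _ <= X](bigD1 x) //= => le1.
have le2 : \sum_(i | i != x) #|S i| <= \sum_(i | i != x) #|S' i|.
  by apply: leq_sum.
rewrite -(leq_add2r (\sum_(i | i != x) #|S' i|)); apply: leq_trans le1 _.
by rewrite leq_add2l.
Qed.

(** A representation of least weight admits no strict reduction; [down] shows that there is a weight
    to minimize. *)
Lemma irreducible_rep_exists :
  exists (T : finType) (S : P -> {set T}), irreducible_rep S.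
Proof.
pose Q m := `[< exists (T : finType) (S : P -> {set T}),
                  inclusion_rep S /\ rep_weight S = m >].
have exQ : exists m, Q m.
  exists (rep_weight down); apply/asboolP.
  by exists P, down; split=> //; apply: inclusion_rep_down.
case: (ex_minnP exQ) => m /asboolP [T [S [repS wS]]] minm.
exists T, S; split=> // -[T' [S' [repS' /strict_reduction_weight]]].
rewrite wS ltnNge minm //; apply/asboolP.
by exists T', S'.
Qed.

Section Exchange.

Variables (T : finType) (S : P -> {set T}) (D : {set P}).

Let G : {set T} := \bigcup_(x in D) S x.

Definition exchange (x : P) : {set T + P} :=
  inl @: (S x :&: G) :|: inr @: (down x :\: D).

Lemma mem_exchange_inl x t : (inl t \in exchange x) = (t \in S x :&: G).
Proof.
rewrite /exchange in_setU (mem_imset _ _ (@inl_inj _ _)).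
by case: imsetP => [[?]|] //; rewrite orbF.
Qed.

Lemma mem_exchange_inr x z : (inr z \in exchange x) = (z \in down x :\: D).
Proof.
rewrite /exchange in_setU (mem_imset _ _ (@inr_inj _ _)).
by case: imsetP => [[?]|] //.
Qed.

Lemma card_inl_inr (A : {set T}) (B : {set P}) :
  #|(inl @: A :|: inr @: B : {set T + P})| = #|A| + #|B|.
Proof.
rewrite cardsU !card_imset; try by move=> ? ? [].
rewrite (_ : _ :&: _ = set0) ?cards0 ?subn0 //.
by apply/setP=> u; rewrite !inE; apply/andP=> -[/imsetP[a _ ->] /imsetP[]].
Qed.

Hypothesis repS : inclusion_rep S.
(** Adding [#|~: D|] instead of subtracting [#|D|] shifts the cost by the constant [#|P|] and avoids
    truncated subtraction. *)
Hypothesis minD : forall D' : {set P},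
  #|G| + #|~: D| <= #|\bigcup_(x in D') S x| + #|~: D'|.

Lemma card_downD x : #|down x :\: D| <= #|S x :\: G|.
Proof.
(* Enlarging [D] by all of [down x] costs only the points of [S x], since [S z] lies in [S x] for
   every [z] below [x]. *)
have GU : \bigcup_(z in D :|: down x) S z = G :|: S x.
  apply/eqP; rewrite eqEsubset; apply/andP; split.
    apply/bigcupsP=> z; rewrite in_setU => /orP[zD|].
      by apply: subset_trans (subsetUl _ _); apply: bigcup_sup.
    by rewrite inE => /repS zx; apply: subset_trans zx (subsetUr _ _).
  rewrite subUset; apply/andP; split.
    by apply/bigcupsP=> z zD; apply: bigcup_sup; rewrite in_setU zD.
  by apply: bigcup_sup; rewrite !inE lexx orbT.
have := minD (D :|: down x); rewrite GU.
have -> : #|G :|: S x| = #|G| + #|S x :\: G|.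
  by rewrite -(cardsID G (G :|: S x)) setUK setDUl setDv set0U.
have -> : #|~: D| = #|down x :\: D| + #|~: (D :|: down x)|.
  by rewrite -(cardsID (down x) (~: D)) setIC -setDE setCU -setDE.
by rewrite addnA leq_add2r leq_add2l.
Qed.

(** To reflect the order: if [x] is in [D], then [S x] lies in [G], so no old point of [x] was lost;
    otherwise the new point [inr x] lies only in the sets of elements above [x]. *)
Lemma inclusion_rep_exchange : inclusion_rep exchange.
Proof.
move=> x y; split=> [xy | sub].
  have /subsetP dxy := (inclusion_rep_down x y).1 xy.
  have /subsetP sxy := (repS x y).1 xy.
  apply/subsetP=> -[t | z].
    by rewrite !mem_exchange_inl !in_setI => /andP[/sxy -> ->].
  by rewrite !mem_exchange_inr !in_setD => /andP[-> /dxy ->].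
have [xD | xD] := boolP (x \in D).
  apply/repS/subsetP=> t tx.
  have tG : t \in G by apply/bigcupP; exists x.
  have := subsetP sub (inl t).
  by rewrite !mem_exchange_inl !in_setI tx tG !andbT; apply.
have := subsetP sub (inr x).
by rewrite !mem_exchange_inr !in_setD xD !inE lexx; apply.
Qed.

Lemma card_exchange_lt :
  #|P| < #|ground S| -> #|ground exchange| < #|ground S| /\
  forall x, #|exchange x| <= #|S x|.
Proof.
move=> big; split; last first.
  by move=> x; rewrite card_inl_inr -(cardsID G (S x)) leq_add2l card_downD.
have GP : #|G| + #|~: D| <= #|P|.
  by have := minD set0; rewrite big_set0 cards0 setC0 cardsT.
(* The new ground set sits inside the disjoint union of [G] and [~: D]. *)
apply: leq_ltn_trans big; apply: leq_trans GP; rewrite -card_inl_inr.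
apply/subset_leq_card/bigcupsP=> x _; apply: setUSS; apply: imsetS.
  exact: subsetIr.
by rewrite setDE subsetIr.
Qed.

End Exchange.

Lemma irreducible_size_le w : irreducible_size P w -> w <= #|P|.
Proof.
move=> [T [S [[repS irrS] <-]]]; rewrite leqNgt; apply/negP=> big.
pose cost (D : {set P}) := #|\bigcup_(x in D) S x| + #|~: D|.
case: (@arg_minnP _ set0 xpredT cost isT) => D _ minD.
have minD' D' := minD D' isT.
have [gE sE] := card_exchange_lt repS minD' big.
apply: irrS; exists (T + P)%type, (exchange S D); split.
  exact: inclusion_rep_exchange.
split; first by split=> //; apply: ltnW.
by move=> [_ [gE' _]]; move: gE; rewrite ltnNge gE'.
Qed.

End IrreducibleRepresentations.

Theorem theorem1p3 (d : Order.disp_t) (P : finPOrderType d) (hP : 0 < #|P|) :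
  exists w : nat, is_iir P w /\ w <= #|P|.
Proof.
pose Q w := `[< irreducible_size P w >].
have exQ : exists w, Q w.
  have [T [S irrS]] := irreducible_rep_exists P.
  by exists #|ground S|; apply/asboolP; exists T, S.
have leQ w : Q w -> w <= #|P| by move=> /asboolP /irreducible_size_le.
(* The bound also serves to show that the maximum is attained. *)
case: (ex_maxnP exQ leQ) => w Qw maxw; exists w; split; last exact: leQ.
by split=> [|v irrv]; [apply/asboolP | apply: maxw; apply/asboolP].
Qed.
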